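(* Let $m\geq 1$ and let $X_1,\dots,X_m$ be elements of a commutative ring (e.g. indeterminates). Let $\mathbf{A}$ be the $2m\times 2m$ matrix $\mathbf{A}=\begin{bmatrix}\mathbf{A}_1\\ \mathbf{A}_2\end{bmatrix}$, where $\mathbf{A}_1=[X_i^{j-1}]_{1\leq i\leq m,\,1\leq j\leq 2m}$ and $\mathbf{A}_2=[jX_i^{j-1}]_{1\leq i\leq m,\,1\leq j\leq 2m}$ (here $i$ indexes rows and $j$ indexes columns). That is, for $1\le i\le m$, row $i$ of $\mathbf{A}$ is $(1, X_i, X_i^2,\dots,X_i^{2m-1})$ and row $m+i$ is $(1, 2X_i, 3X_i^2,\dots,2mX_i^{2m-1})$. Then $$\det\mathbf{A}=(-1)^{\frac{m(m-1)}{2}}\prod_{i=1}^m X_i\prod_{1\leq i<j\leq m}(X_j-X_i)^4.$$ *)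

(* Defs.v *)
From HB Require Import structures.
From mathcomp Require Import all_boot all_order all_algebra.
Set Implicit Arguments.
Unset Strict Implicit.
Unset Printing Implicit Defensive.
Import GRing.Theory.
Local Open Scope ring_scope.

(* Ordinals start at 0, so column j : 'I_(m + m) is the mathematical column
   j + 1: the exponent is j and the coefficient in matA2 is j + 1. The size is
   m + m so that the stacked matrix is square by conversion. *)
Definition matA1 (R : comPzRingType) (m : nat) (X : 'I_m -> R)
    : 'M[R]_(m, m + m) :=
  \matrix_(i < m, j < m + m) X i ^+ j.

Definition matA2 (R : comPzRingType) (m : nat) (X : 'I_m -> R)
    : 'M[R]_(m, m + m) :=
  \matrix_(i < m, j < m + m) (j.+1%:R * X i ^+ j).

Definition matA (R : comPzRingType) (m : nat) (X : 'I_m -> R)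
    : 'M[R]_(m + m) :=
  col_mx (matA1 X) (matA2 X).

(* Main.v *)
(** Deform the statement to R[q].  The q-analogue of [A], whose lower entries
    are [(1 + q + ... + q^j) X_i^j], specialises to [A] at [q = 1].  Since
    [(q - 1)(1 + ... + q^j) X_i^j = q (q X_i)^j - X_i^j], multiplying its lower
    rows by [q - 1] gives row combinations of the ordinary Vandermonde matrix at
    the [2m] points [X_i] and [q X_i], whose determinant contains the factors
    [q X_i - X_i].  The factor [(q - 1)^m] thus appears on both sides; it is
    monic, hence can be cancelled over any ring, before putting [q = 1]. *)
Require Import Defs.
From HB Require Import structures.
From mathcomp Require Import all_boot all_order all_algebra ring.
Set Implicit Arguments.
Unset Strict Implicit.
Unset Printing Implicit Defensive.
Import GRing.Theory.
Local Open Scope ring_scope.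

Lemma prod_ord_lt_const (R : comPzRingType) (m : nat) (c : R) :
  \prod_(i < m) \prod_(j < m | (i < j)%N) c = c ^+ ((m * (m - 1)) %/ 2).
Proof.
rewrite (exchange_big_dep xpredT) //= subn1 divn2 -bin2 -bin2_sum big_mkord.
rewrite expr_sum; apply: eq_bigr => i _.
by rewrite -(big_ord_widen _ (fun=> c)) 1?ltnW // prodr_const card_ord.
Qed.

(** Each unordered pair of indices occurs twice, with opposite signs, so it yields minus a square;
    there are [m (m - 1) / 2] such pairs. *)
Lemma prod_sub_neq (R : comPzRingType) (m : nat) (X : 'I_m -> R) :
  \prod_(i < m) \prod_(j < m | j != i) (X j - X i) =
    (-1) ^+ ((m * (m - 1)) %/ 2)
    * \prod_(i < m) \prod_(j < m | (i < j)%N) (X j - X i) ^+ 2.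
Proof.
transitivity ((\prod_(i < m) \prod_(j < m | (i < j)%N) (X j - X i))
    * \prod_(i < m) \prod_(j < m | (j < i)%N) (X j - X i)).
  rewrite -big_split; apply: eq_bigr => i _ /=.
  rewrite (bigID (fun j : 'I_m => (i < j)%N)) /=.
  by congr (_ * _); apply: eq_bigl => j; rewrite -val_eqE /=; case: ltngtP.
rewrite [X in _ * X](exchange_big_dep xpredT) //=.
rewrite -prod_ord_lt_const -!big_split.
apply: eq_bigr => i _ /=; rewrite -!big_split; apply: eq_bigr => j _ /=.
by rewrite -[X i - X j]opprB mulN1r mulrN expr2.
Qed.

(** The row operation is left multiplication by a block lower triangular matrix with diagonal blocks
    [1] and [d]. *)
Lemma det_col_mx_comb (R : comPzRingType) (m : nat) (c d : R)
    (A B : 'M[R]_(m, m + m)) :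
  \det (col_mx A (c *: A + d *: B)) = d ^+ m * \det (col_mx A B).
Proof.
have -> : col_mx A (c *: A + d *: B)
  = block_mx 1%:M 0 c%:M d%:M *m col_mx A B.
  by rewrite mul_block_col mul1mx mul0mx addr0 !mul_scalar_mx.
by rewrite det_mulmx det_lblock det1 mul1r det_scalar.
Qed.

Lemma det_col_mx_matA1 (R : comPzRingType) (m : nat) (X Y : 'I_m -> R) :
  \det (col_mx (matA1 X) (matA1 Y)) =
    (\prod_(i < m) \prod_(j < m | (i < j)%N) (X j - X i))
    * (\prod_(i < m) \prod_(j < m) (Y j - X i))
    * \prod_(i < m) \prod_(j < m | (i < j)%N) (Y j - Y i).
Proof.
pose a : 'rV[R]_(m + m) := row_mx (\row_i X i) (\row_i Y i).
have al i : a 0 (lshift m i) = X i by rewrite row_mxEl mxE.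
have ar i : a 0 (rshift m i) = Y i by rewrite row_mxEr mxE.
(* In [Vandermonde] the points index the columns, hence the transpose. *)
have -> : col_mx (matA1 X) (matA1 Y) = (Vandermonde (m + m) a)^T.
  rewrite -[RHS]vsubmxK; congr col_mx; apply/matrixP => i j.
    by rewrite !mxE -al mxE.
  by rewrite !mxE -ar mxE.
rewrite det_tr det_Vandermonde big_split_ord /=; congr (_ * _).
  rewrite -big_split; apply: eq_bigr => i _ /=.
  rewrite big_split_ord /=; congr (_ * _).
    by apply: eq_bigr => j _; rewrite !al.
  (* Every index of the first half precedes every index of the second, so the mixed product is
     unrestricted. *)
  apply: eq_big => [j|j _]; last by rewrite al ar.
  by rewrite (leq_trans (ltn_ord i)) ?leq_addr.
apply: eq_bigr => i _; rewrite big_split_ord /= big_pred0 ?mul1r => [|j].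
  by apply: eq_big => [j|j _]; rewrite ?ltn_add2l ?ar.
by apply/negbTE; rewrite -leqNgt ltnW // (leq_trans (ltn_ord j)) ?leq_addr.
Qed.

Definition qmatA2 (R : comPzRingType) (m : nat) (q : R) (X : 'I_m -> R)
    : 'M[R]_(m, m + m) :=
  \matrix_(i < m, j < m + m) ((\sum_(k < j.+1) q ^+ k) * X i ^+ j).

(** The factor [(q - 1) ^+ m] stays on both sides, since [q - 1] may be a zero divisor for a general
    [q]. *)
Lemma det_qmatA (R : comPzRingType) (m : nat) (q : R) (X : 'I_m -> R) :
  (q - 1) ^+ m * \det (col_mx (matA1 X) (qmatA2 q X)) =
  (q - 1) ^+ m * (q ^+ m
    * ((\prod_(i < m) \prod_(j < m | (i < j)%N) (X j - X i))
       * ((\prod_(i < m) X i)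
          * \prod_(i < m) \prod_(j < m | j != i) (q * X j - X i))
       * \prod_(i < m) \prod_(j < m | (i < j)%N) (q * X j - q * X i))).
Proof.
have diag : \prod_(i < m) \prod_(j < m) (q * X j - X i) = (q - 1) ^+ m
    * ((\prod_(i < m) X i)
       * \prod_(i < m) \prod_(j < m | j != i) (q * X j - X i)).
  rewrite -[X in _ ^+ X]card_ord -prodr_const -!big_split /=.
  apply: eq_bigr => i _.
  by rewrite (bigD1 i) //= [RHS]mulrA [in RHS]mulrBl mul1r.
have -> : (q - 1) ^+ m * \det (col_mx (matA1 X) (qmatA2 q X))
    = q ^+ m * \det (col_mx (matA1 X) (matA1 (fun i => q * X i))).
  (* On the left the lower rows are scaled by [q - 1]; on the right they are scaled by [q] and the
     upper rows subtracted. Both give [(q ^+ j.+1 - 1) * X i ^+ j]. *)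
  rewrite -(det_col_mx_comb 0) -(det_col_mx_comb (-1)).
  congr (\det (col_mx _ _)).
  apply/matrixP => i j; rewrite !mxE mul0r add0r mulrA -subrX1.
  by rewrite exprMn mulrA -exprS mulrBl addrC mulN1r mul1r.
rewrite det_col_mx_matA1 diag [RHS]mulrCA.
by congr (_ * _); rewrite mulrCA !mulrA.
Qed.

Lemma det_matA_nz (R : comNzRingType) (m : nat) (X : 'I_m -> R) :
  \det (matA X) =
    (-1) ^+ ((m * (m - 1)) %/ 2)%N * (\prod_(i < m) X i)
    * \prod_(i < m) \prod_(j < m | (i < j)%N) (X j - X i) ^+ 4.
Proof.
have reg : GRing.lreg (('X - 1 : {poly R}) ^+ m).
  by apply/lregX/monic_lreg; rewrite -[1]/(1%:P) monicXsubC.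
(* Take [q] to be the indeterminate and the points constant, cancel the regular factor, then
   evaluate at 1. *)
have /reg/(congr1 (horner_eval 1)) := det_qmatA 'X (fun i => (X i)%:P).
have evalC i : horner_eval 1 (X i)%:P = X i by rewrite horner_evalE hornerC.
have evalX : horner_eval 1 'X = 1 :> R by rewrite horner_evalE hornerX.
have evalPP (P : 'I_m -> pred 'I_m) (F : 'I_m -> 'I_m -> {poly R}) :
    horner_eval 1 (\prod_(i < m) \prod_(j < m | P i j) F i j)
    = \prod_(i < m) \prod_(j < m | P i j) horner_eval 1 (F i j).
  by rewrite rmorph_prod; apply: eq_bigr => i _; rewrite rmorph_prod.
rewrite -det_map_mx map_col_mx.
have -> : map_mx (horner_eval 1) (matA1 (fun i => (X i)%:P)) = matA1 X.
  by apply/matrixP => i j; rewrite !mxE rmorphXn /= evalC.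
have -> : map_mx (horner_eval 1) (qmatA2 'X (fun i => (X i)%:P)) = matA2 X.
  apply/matrixP => i j; rewrite !mxE rmorphM rmorphXn /= evalC; congr (_ * _).
  rewrite rmorph_sum /=; under eq_bigr do rewrite rmorphXn /= evalX expr1n.
  by rewrite sumr_const card_ord.
rewrite -/(matA X) => ->; rewrite !rmorphM rmorphXn /= evalX expr1n mul1r.
rewrite !evalPP rmorph_prod /=.
under eq_bigr do under eq_bigr do rewrite rmorphB /= !evalC.
under [X in _ * (X * _)]eq_bigr do rewrite evalC.
under [X in _ * (_ * X)]eq_bigr do
  under eq_bigr do rewrite rmorphB rmorphM /= evalX !evalC mul1r.
under [X in _ * _ * X]eq_bigr do
  under eq_bigr do rewrite rmorphB !rmorphM /= evalX !evalC !mul1r.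
(* At [q = 1] the mixed factors give the sign and the squares; the two Vandermonde products raise
   the exponent to 4. *)
rewrite prod_sub_neq.
under [X in _ * (_ * (_ * X)) * _]eq_bigr do rewrite prodrXl.
under [X in _ = _ * X]eq_bigr do rewrite prodrXl.
by rewrite !prodrXl; ring.
Qed.

Theorem theorem1 (R : comPzRingType) (m : nat) (hm : (1 <= m)%N)
    (X : 'I_m -> R) :
  \det (matA X) =
    (-1) ^+ ((m * (m - 1)) %/ 2)%N * (\prod_(i < m) X i)
    * \prod_(i < m) \prod_(j < m | (i < j)%N) (X j - X i) ^+ 4.
Proof.
(* The zero ring is treated apart, as the cancellation is done over a nonzero ring. Otherwise [R']
   is [R] itself with [1 != 0] recorded. *)
have [R0 | R1] := eqVneq (1 : R) 0.
  have eq0 (x : R) : x = 0 by rewrite -[x]mul1r R0 mul0r.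
  by rewrite [LHS]eq0 [RHS]eq0.
pose nzR := GRing.PzSemiRing_isNonZero.Build R R1.
pose R' : comNzRingType := HB.pack R (GRing.ComPzRing.class R) nzR.
exact: (@det_matA_nz R' m X).
Qed.
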